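(* Let $N\ge3$, $\lambda=\Lambda>0$, $p,q>0$, $pq>1$, and assume that $(p,q)$ is below or on the hyperbola $\mathcal{H}$, i.e. $\alpha+\beta\ge N-2$. Let $(u,v)$ be a regular radial solution of $$\lambda\Delta u+v^p=0,\qquad \lambda\Delta v+u^q=0,\qquad u,v>0\quad\text{in }\Omega,$$ where either $\Omega=\mathbb{R}^N$, or $\Omega=B_R$ for some $R>0$ and $u=v=0$ on $\partial B_R$. Then $u$ and $v$, as functions of $r=|x|$, change concavity exactly once.
   Context: $\alpha=\frac{2(p+1)}{pq-1}$, $\beta=\frac{2(q+1)}{pq-1}$. The hyperbola $\mathcal{H}$ is $\{(p,q):\alpha+\beta=N-2\}$, equivalently $\frac1{p+1}+\frac1{q+1}=\frac{N-2}{N}$; the region below $\mathcal{H}$ is $\alpha+\beta>N-2$ (with $p,q>0$, $pq>1$). $B_R$ is the ball of radius $R$ centered at the origin. Solutions are classical; a radial solution pair is regular if $u$ and $v$, together with their derivatives, are continuously defined at $x=0$. ''Changes concavity exactly once'' means that the second derivative with respect to $r$ changes sign exactly once in the interval of positive $r$ where the solution is defined. *)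

(* Defs.v *)
From mathcomp Require Import all_boot all_order all_algebra.
From mathcomp Require Import all_classical all_reals all_analysis.

Set Implicit Arguments.
Unset Strict Implicit.
Unset Printing Implicit Defensive.

Import Order.TTheory GRing.Theory Num.Theory.
Import numFieldNormedType.Exports.

Local Open Scope classical_set_scope.
Local Open Scope ring_scope.

(* The norm that the library puts on row vectors is the sup norm, so |x| has to
   be defined; the two norms induce the same topology. *)
Definition enorm (R : realType) (N : nat) (x : 'rV[R]_N) : R :=
  Num.sqrt (\sum_(i < N) x ord0 i ^+ 2).

Definition eball (R : realType) (N : nat) (rho : R) : set 'rV[R]_N :=
  [set x | enorm x < rho].

Definition cleball (R : realType) (N : nat) (rho : R) : set 'rV[R]_N :=
  [set x | enorm x <= rho].

Definition partial (R : realType) (N : nat) (i : 'I_N) (f : 'rV[R]_N -> R)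
    (x : 'rV[R]_N) : R :=
  'D_(delta_mx ord0 i) f x.

Definition laplacian (R : realType) (N : nat) (f : 'rV[R]_N -> R)
    (x : 'rV[R]_N) : R :=
  \sum_(i < N) partial i (partial i f) x.

(* [Omega] is meant to be open in [C1_on] and [C2_on]. *)
Definition C1_on (R : realType) (N : nat) (Omega : set 'rV[R]_N)
    (f : 'rV[R]_N -> R) : Prop :=
  forall x, Omega x ->
    {for x, continuous f} /\
    forall i : 'I_N,
      derivable f x (delta_mx ord0 i) /\ {for x, continuous (partial i f)}.

Definition C2_on (R : realType) (N : nat) (Omega : set 'rV[R]_N)
    (f : 'rV[R]_N -> R) : Prop :=
  C1_on Omega f /\ forall i : 'I_N, C1_on Omega (partial i f).

Definition classical_solution (R : realType) (N : nat) (lambda p q : R)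
    (Omega : set 'rV[R]_N) (u v : 'rV[R]_N -> R) : Prop :=
  [/\ C2_on Omega u, C2_on Omega v
    & forall x, Omega x ->
        [/\ lambda * laplacian u x + v x `^ p = 0,
            lambda * laplacian v x + u x `^ q = 0,
            0 < u x & 0 < v x]].

Definition dirichlet_on_ball (R : realType) (N : nat) (rho : R)
    (f : 'rV[R]_N -> R) : Prop :=
  {within cleball (N := N) rho, continuous f} /\
  forall x, enorm x = rho -> f x = 0.

Definition radial_profile (R : realType) (N : nat) (Omega : set 'rV[R]_N)
    (f : 'rV[R]_N -> R) (F : R -> R) : Prop :=
  forall x, Omega x -> f x = F (enorm x).

Definition positive_radii (R : realType) (N : nat) (Omega : set 'rV[R]_N) :
    set R :=
  [set r | 0 < r /\ exists2 x, Omega x & enorm x = r].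

(* [g] has a constant strict sign on [I] before [c] and the opposite strict sign
   on [I] after [c]; both parts are nonempty when [I] is an open interval. *)
Definition changes_sign_exactly_once (R : realType) (I : set R) (g : R -> R) :
    Prop :=
  exists2 c, I c & forall r s, I r -> I s -> r < c -> c < s -> g r * g s < 0.

Definition changes_concavity_exactly_once (R : realType) (I : set R)
    (F : R -> R) : Prop :=
  changes_sign_exactly_once I (F^`(2))%classic.

Definition alpha_exp (R : realType) (p q : R) : R := 2 * (p + 1) / (p * q - 1).
Definition beta_exp (R : realType) (p q : R) : R := 2 * (q + 1) / (p * q - 1).

(* Main.v *)
(** With [m = - u'], [n = - v'], [f = v ^ p / lambda], [g = u ^ q / lambda], put
[X = r m / u], [Y = r n / v], [Z = r f / m], [W = r g / n].  In the variable
[t = ln r] the radial system becomes autonomous: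
  X' = X (X + Z - (N - 2)),  Z' = Z (N - p Y - Z),
  Y' = Y (Y + W - (N - 2)),  W' = W (N - q X - W),
and [u'' = (m / r) (N - 1 - Z)], so it suffices that [Z], which starts at [N],
is strictly decreasing and gets below [N - 1].  As long as [Y] increases,
[N - p Y - Z] stays negative, so the point is that [X] and [Y] always increase.
Suppose that this fails, and that [Y] stops increasing first.  Then [W] is
decreasing, and [Y] and [W] go on decreasing unless the sign of [N - q X - W]
changes at some later point.  There [X + Z <= N - 2], [Y + W <= N - 2] and
[W = N - q X], which is incompatible with the Pohozaev energy being nonnegative
(this is where the position relative to the hyperbola enters).  So [Y] decreases
forever, exponentially in [t], hence [v] is bounded below by a positive constant.
This contradicts [v = 0] on the boundary of the ball and, in the whole space, it
would drive [u] below zero. *)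

Require Import Defs.
From mathcomp Require Import all_boot all_order all_algebra.
From mathcomp Require Import all_classical all_reals all_analysis.
From mathcomp Require Import ring lra.
Import Order.TTheory GRing.Theory Num.Theory.
Import numFieldNormedType.Exports.
Local Open Scope classical_set_scope.
Local Open Scope ring_scope.

(** * Calculus rules for real functions of one variable *)

Lemma derivD {R : realType} {f g : R -> R} {x df dg : R} :
  is_derive x 1 f df -> is_derive x 1 g dg ->
  is_derive x 1 (fun y => f y + g y) (df + dg).
Proof. by move=> hf hg; exact: is_deriveD. Qed.

Lemma derivB {R : realType} {f g : R -> R} {x df dg : R} :
  is_derive x 1 f df -> is_derive x 1 g dg ->
  is_derive x 1 (fun y => f y - g y) (df - dg).
Proof. by move=> hf hg; exact: is_deriveB. Qed.

Lemma derivM {R : realType} {f g : R -> R} {x df dg : R} :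
  is_derive x 1 f df -> is_derive x 1 g dg ->
  is_derive x 1 (fun y => f y * g y) (df * g x + f x * dg).
Proof.
move=> hf hg; apply: (is_derive_eq (is_deriveM hf hg)).
by rewrite /GRing.scale /= addrC (mulrC (g x)).
Qed.

Lemma derivC {R : realType} (c x : R) : is_derive x 1 (fun=> c) 0.
Proof. exact: is_derive_cst. Qed.

Lemma derivI {R : realType} (x : R) : is_derive x 1 (fun y : R => y) 1.
Proof. exact: is_derive_id. Qed.

Lemma derivX {R : realType} (n : nat) (x : R) :
  is_derive x 1 (fun y => y ^+ n.+1) (n.+1%:R * x ^+ n).
Proof.
have h := is_deriveX n.+1 (derivI x); rewrite exprfctE in h.
apply: (is_derive_eq h); by rewrite /GRing.scale /= mulr1.
Qed.

Lemma derivV {R : realType} {f : R -> R} {x df : R} :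
  f x != 0 -> is_derive x 1 f df ->
  is_derive x 1 (fun y => (f y)^-1) (- df / f x ^+ 2).
Proof.
move=> fx hf; apply: (is_derive_eq (is_deriveV fx hf)).
by rewrite /GRing.scale /= !mulNr mulrC.
Qed.

Lemma derivln {R : realType} {f : R -> R} {x df : R} :
  0 < f x -> is_derive x 1 f df ->
  is_derive x 1 (fun y => ln (f y)) (df / f x).
Proof.
move=> fx hf; apply: (is_derive_eq (is_derive1_comp (is_derive1_ln fx) hf)).
by rewrite mulrC.
Qed.

Lemma contD {R : realType} {f g : R -> R} {x : R} :
  continuous_at x f -> continuous_at x g ->
  continuous_at x (fun y : R => f y + g y).
Proof. by move=> hf hg; exact: continuousD. Qed.

Lemma contB {R : realType} {f g : R -> R} {x : R} :
  continuous_at x f -> continuous_at x g ->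
  continuous_at x (fun y : R => f y - g y).
Proof. by move=> hf hg; exact: continuousB. Qed.

Lemma contN {R : realType} {f : R -> R} {x : R} :
  continuous_at x f -> continuous_at x (fun y : R => - f y).
Proof. by move=> hf; exact: continuousN. Qed.

Lemma contM {R : realType} {f g : R -> R} {x : R} :
  continuous_at x f -> continuous_at x g ->
  continuous_at x (fun y : R => f y * g y).
Proof. by move=> hf hg; exact: continuousM. Qed.

Lemma contC {R : realType} (c x : R) : continuous_at x (fun=> c : R).
Proof. exact: cst_continuous. Qed.

Lemma contI {R : realType} (x : R) : continuous_at x (fun y : R => y).
Proof. by move=> ?; exact. Qed.

Lemma contX {R : realType} (n : nat) (x : R) :
  continuous_at x (fun y : R => y ^+ n).
Proof. exact: exprn_continuous. Qed.

Lemma contV {R : realType} {f : R -> R} {x : R} :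
  f x != 0 -> continuous_at x f -> continuous_at x (fun y : R => (f y)^-1).
Proof. by move=> fx hf; exact: continuousV. Qed.

Lemma deriv_cont {R : realType} {f : R -> R} {x df : R} :
  is_derive x 1 f df -> continuous_at x f.
Proof.
by move=> hf; apply: differentiable_continuous; apply/derivable1_diffP; case: hf.
Qed.

Lemma cont_near_gt {R : realType} {f : R -> R} {x c : R} :
  continuous_at x f -> c < f x ->
  exists2 d, 0 < d & forall y, `|y - x| < d -> c < f y.
Proof.
move=> hf cx.
have : nbhs x (fun y => c < f y) by exact: (@cvgr_gt R _ (nbhs x) _ f (f x) hf).
move=> /nbhs_ballP[d /= d0 hd].
exists d => // y yx; apply: hd; rewrite /ball/= distrC; exact: yx.
Qed.

Lemma cont_segment {R : realType} {f : R -> R} {a b : R} :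
  (forall x, a <= x <= b -> continuous_at x f) ->
  {within `[a, b], continuous f}.
Proof.
move=> hf; apply: continuous_in_subspaceT => x; rewrite inE/= in_itv/=.
exact: hf.
Qed.

(** * Monotonicity on segments and first zeros *)

Lemma segment_MVT {R : realType} {f df : R -> R} {a b : R} : a < b ->
  (forall x, a <= x <= b -> continuous_at x f) ->
  (forall x, a < x < b -> is_derive x 1 f (df x)) ->
  exists2 c, a < c < b & f b - f a = df c * (b - a).
Proof.
move=> ab cf hf.
have dI x : x \in `]a, b[ -> is_derive x 1 f (df x) by rewrite in_itv/=; exact: hf.
have [c] := MVT ab dI (cont_segment cf).
by rewrite in_itv/= => hc e; exists c.
Qed.

Lemma segment_lt {R : realType} {f : R -> R} (df : R -> R) {a b : R} : a < b ->
  (forall x, a <= x <= b -> continuous_at x f) ->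
  (forall x, a < x < b -> is_derive x 1 f (df x)) ->
  (forall x, a < x < b -> 0 < df x) -> f a < f b.
Proof.
move=> ab cf hf dp; have [c hc e] := segment_MVT ab cf hf.
by rewrite -subr_gt0 e mulr_gt0 ?subr_gt0 ?dp.
Qed.

Lemma segment_le {R : realType} {f : R -> R} (df : R -> R) {a b : R} : a <= b ->
  (forall x, a <= x <= b -> continuous_at x f) ->
  (forall x, a < x < b -> is_derive x 1 f (df x)) ->
  (forall x, a < x < b -> 0 <= df x) -> f a <= f b.
Proof.
rewrite le_eqVlt => /orP[/eqP -> //|ab] cf hf dp.
have [c hc e] := segment_MVT ab cf hf.
by rewrite -subr_ge0 e mulr_ge0 ?subr_ge0 ?dp// ltW.
Qed.

Lemma segment_gt {R : realType} {f : R -> R} (df : R -> R) {a b : R} : a < b ->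
  (forall x, a <= x <= b -> continuous_at x f) ->
  (forall x, a < x < b -> is_derive x 1 f (df x)) ->
  (forall x, a < x < b -> df x < 0) -> f b < f a.
Proof.
move=> ab cf hf dn; have [c hc e] := segment_MVT ab cf hf.
by rewrite -subr_lt0 e pmulr_llt0 ?subr_gt0 ?dn.
Qed.

Lemma segment_ge {R : realType} {f : R -> R} (df : R -> R) {a b : R} : a <= b ->
  (forall x, a <= x <= b -> continuous_at x f) ->
  (forall x, a < x < b -> is_derive x 1 f (df x)) ->
  (forall x, a < x < b -> df x <= 0) -> f b <= f a.
Proof.
rewrite le_eqVlt => /orP[/eqP -> //|ab] cf hf dn.
have [c hc e] := segment_MVT ab cf hf.
by rewrite -subr_le0 e pmulr_lle0 ?subr_gt0 ?dn.
Qed.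

(** The point is the infimum of the set where [h <= 0]. Continuity gives [h t <= 0] there, and
    [h t < 0] would spread to points on the left, which lie before the infimum. *)
Lemma first_nonpos {R : realType} {h : R -> R} {a b : R} : a <= b ->
  (forall x, a <= x <= b -> continuous_at x h) -> 0 < h a -> h b <= 0 ->
  exists2 t, a < t <= b & h t = 0 /\ forall s, a <= s < t -> 0 < h s.
Proof.
move=> ab ch ha hb.
pose E := [set x | a <= x <= b /\ h x <= 0].
have Eb : E b by split; rewrite ?ab ?lexx.
have lbE : lbound E a by move=> x [/andP[]].
have infE : has_inf E by split; [exists b | exists a].
set t := inf E.
have at_ : a <= t by apply: lb_le_inf => //; exists b.
have tb : t <= b by apply: ge_inf => //; exists a.
have pos s : a <= s < t -> 0 < h s.
  move=> /andP[as_ st]; rewrite ltNge; apply/negP => hs.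
  have : E s by split => //; rewrite as_ (le_trans (ltW st)).
  by move=> /(ge_inf (ex_intro _ a lbE)); rewrite leNgt st.
have ct := ch t; rewrite at_ tb in ct.
have ht : h t <= 0.
  rewrite leNgt; apply/negP => ht.
  have [d d0 hd] := cont_near_gt (ct isT) ht.
  have [x [/andP[ax xb] hx] xt] := inf_adherent d0 infE.
  have tx : t <= x by apply: ge_inf => //; [exists a | split; rewrite ?ax].
  have : 0 < h x by apply: hd; rewrite ger0_norm ?subr_ge0// ltrBlDl.
  by rewrite ltNge hx.
have alt : a < t.
  by rewrite lt_neqAle at_ andbT; apply/eqP => e; move: ha; rewrite e ltNge ht.
exists t; first by rewrite alt.
split => //; apply/eqP; rewrite eq_le ht /= leNgt; apply/negP => htn.
have nht : 0 < - h t by rewrite oppr_gt0.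
have cn : continuous_at t (fun y : R => - h y) by apply: contN; exact: ct.
have [d d0 hd] := cont_near_gt cn nht.
pose s := Num.max a (t - d / 2).
have st : s < t by rewrite gt_max alt ltrBlDr ltrDl divr_gt0.
have : 0 < h s by apply: pos; rewrite st le_max lexx.
apply/negP; rewrite -leNgt -oppr_ge0 ltW//; apply: hd.
rewrite ltr0_norm ?subr_lt0// opprB.
have : t - d / 2 <= s by rewrite le_max lexx orbT.
by lra.
Qed.

(* Both premises are packed in a conjunction so that type class resolution does
   not close the first one with a derivative of its own choice. *)
Lemma deriv_eq {R : realType} {f : R -> R} {x df df' : R} :
  is_derive x 1 f df' /\ df' = df -> is_derive x 1 f df.
Proof. by move=> [hf <-]. Qed.

Ltac derivs := lazymatch goal with
  | |- is_derive _ _ (fun y => ?f + - ?g) _ => eapply derivB; derivs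
  | |- is_derive _ _ (fun y => ?f + ?g) _ => eapply derivD; derivs
  | |- is_derive _ _ (fun y => ?f * ?g) _ => eapply derivM; derivs
  | |- is_derive _ _ (fun y => ?f ^+ _) _ => eapply derivX
  | |- is_derive _ _ (fun y => ?f^-1) _ => eapply derivV; derivs
  | |- is_derive _ _ (fun y => y) _ => eapply derivI
  | |- is_derive _ _ (fun y => ln ?f) _ => eapply derivln; derivs
  | |- is_derive _ _ _ _ => first [eassumption | eapply derivC]
  | |- _ => assumption
  end.

(** The derivative is computed from the syntax of the function; what remains is its equality with
    the stated one, usually a matter for [field]. *)
Ltac by_derivs := eapply deriv_eq; split; [by derivs | cbv beta].

Ltac conts := lazymatch goal with
  | |- continuous_at _ (fun y => ?f + - ?g) => eapply contB; conts
  | |- continuous_at _ (fun y => ?f + ?g) => eapply contD; conts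
  | |- continuous_at _ (fun y => ?f * ?g) => eapply contM; conts
  | |- continuous_at _ (fun y => ?f ^+ _) => eapply contX
  | |- continuous_at _ (fun y => ?f^-1) => eapply contV; conts
  | |- continuous_at _ (fun y => y) => eapply contI
  | |- continuous_at _ _ => first [eassumption | eapply contC]
  | |- _ => assumption
  end.

(** * The first-order radial system and its ratios *)

(** Treats [[0, rho[] and [[0, +oo[] at once. *)
Record initial_interval {R : realType} (I : set R) : Prop := InitialInterval {
  ii_ge0 : forall r, I r -> 0 <= r;
  ii_down : forall r s, I r -> 0 <= s -> s <= r -> I s;
  ii_open : forall r, I r -> exists2 s, I s & r < s;
  ii_0 : I 0 }.
Arguments ii_ge0 {R I} _ {r}.
Arguments ii_down {R I} _ {r s}.
Arguments ii_open {R I} _ {r}.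
Arguments ii_0 {R I}.

(* One half of the radial system in dimension [j + 2], as a first order system
   with [m = - u'], [n = - v'] and the source [f], a multiple of [v `^ p]. *)
Record half_system {R : realType} (j : nat) (p : R) (I : set R)
    (u m f v n : R -> R) : Prop := HalfSystem {
  hs_u : forall r, I r -> continuous_at r u;
  hs_m : forall r, I r -> continuous_at r m;
  hs_f : forall r, I r -> continuous_at r f;
  hs_u0 : forall r, I r -> 0 < u r;
  hs_f0 : forall r, I r -> 0 < f r;
  hs_du : forall r, I r -> 0 < r -> is_derive r 1 u (- m r);
  hs_dm : forall r, I r -> 0 < r ->
    is_derive r 1 m (f r - j.+1%:R * m r / r);
  hs_df : forall r, I r -> 0 < r -> is_derive r 1 f (- (p * f r * n r / v r)) }.
Arguments hs_u {R j p I u m f v n} _ {r}.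
Arguments hs_m {R j p I u m f v n} _ {r}.
Arguments hs_f {R j p I u m f v n} _ {r}.
Arguments hs_u0 {R j p I u m f v n} _ {r}.
Arguments hs_f0 {R j p I u m f v n} _ {r}.
Arguments hs_du {R j p I u m f v n} _ {r}.
Arguments hs_dm {R j p I u m f v n} _ {r}.
Arguments hs_df {R j p I u m f v n} _ {r}.

(** These are [X] and [Z]; the same definitions applied to [v n] and [n g] give [Y] and [W]. *)
Definition ratX {R : realType} (u m : R -> R) (r : R) := r * m r / u r.
Definition ratZ {R : realType} (m f : R -> R) (r : R) := r * f r / m r.

(** The function [r ^+ j.+1 * m r] vanishes at [0] and has derivative [r ^+ j.+1 * f r > 0]. *)
Lemma slope_gt0 {R : realType} {j : nat} {p : R} {I : set R} {u m f v n : R -> R}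
    (hI : initial_interval I) (H : half_system j p I u m f v n) {r : R} :
  I r -> 0 < r -> 0 < m r.
Proof.
move=> Ir r0; have sub x : 0 <= x <= r -> I x.
  by move=> /andP[x0 xr]; exact: (ii_down hI Ir x0 xr).
have := @segment_lt R (fun y => y ^+ j.+1 * m y) (fun y => y ^+ j.+1 * f y) 0 r r0.
rewrite expr0n mul0r pmulr_rgt0 ?exprn_gt0//; apply => x.
- move=> /sub Ix; have ? := hs_m H Ix; conts.
- move=> /andP[x0 xr]; have Ix : I x by apply: sub; rewrite !ltW.
  have := hs_dm H Ix x0 => dm; by_derivs.
  by rewrite !exprS -!natr1; field; rewrite gt_eqF.
- move=> /andP[x0 xr]; have Ix : I x by apply: sub; rewrite !ltW.
  by rewrite mulr_gt0 ?exprn_gt0 ?(hs_f0 H).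
Qed.

Lemma ratX_gt0 {R : realType} {j : nat} {p : R} {I : set R} {u m f v n : R -> R}
    (hI : initial_interval I) (H : half_system j p I u m f v n) {r : R} :
  I r -> 0 < r -> 0 < ratX u m r.
Proof.
move=> Ir r0; rewrite /ratX divr_gt0 ?(hs_u0 H)// mulr_gt0//.
exact: (slope_gt0 hI H Ir r0).
Qed.

Lemma ratZ_gt0 {R : realType} {j : nat} {p : R} {I : set R} {u m f v n : R -> R}
    (hI : initial_interval I) (H : half_system j p I u m f v n) {r : R} :
  I r -> 0 < r -> 0 < ratZ m f r.
Proof.
move=> Ir r0; rewrite /ratZ divr_gt0 ?(slope_gt0 hI H)// mulr_gt0//.
exact: (hs_f0 H Ir).
Qed.

Lemma ratX_cont {R : realType} {j : nat} {p : R} {I : set R} {u m f v n : R -> R}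
    (H : half_system j p I u m f v n) {r : R} :
  I r -> continuous_at r (ratX u m).
Proof.
move=> Ir; have := hs_u H Ir; have := hs_m H Ir => ? ?.
have u0 : u r != 0 by rewrite gt_eqF// (hs_u0 H).
by rewrite /ratX; conts.
Qed.

Lemma ratX_deriv {R : realType} {j : nat} {p : R} {I : set R}
    {u m f v n : R -> R}
    (hI : initial_interval I) (H : half_system j p I u m f v n) {r : R} :
  I r -> 0 < r -> is_derive r 1 (ratX u m)
    (ratX u m r * (ratX u m r + ratZ m f r - j%:R) / r).
Proof.
move=> Ir r0; have du := hs_du H Ir r0; have dm := hs_dm H Ir r0.
have u0 : u r != 0 by rewrite gt_eqF// (hs_u0 H).
have m0 : m r != 0 by rewrite gt_eqF// (slope_gt0 hI H).
rewrite {1}/ratX; by_derivs.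
by rewrite /ratX /ratZ -!natr1; field; rewrite u0 m0 gt_eqF.
Qed.

Lemma ratZ_deriv {R : realType} {j : nat} {p : R} {I : set R}
    {u m f v n : R -> R}
    (hI : initial_interval I) (H : half_system j p I u m f v n) {r : R} :
  v r != 0 -> I r -> 0 < r -> is_derive r 1 (ratZ m f)
    (ratZ m f r * (j%:R + 2 - p * ratX v n r - ratZ m f r) / r).
Proof.
move=> v0 Ir r0; have df := hs_df H Ir r0; have dm := hs_dm H Ir r0.
have m0 : m r != 0 by rewrite gt_eqF// (slope_gt0 hI H).
rewrite {1}/ratZ; by_derivs.
by rewrite /ratX /ratZ -!natr1; field; rewrite v0 m0 gt_eqF.
Qed.

(** * Behaviour near the centre, Pohozaev energy, and the slope of [W] *)

(** By division by zero or a zero numerator, [ratZ] takes the value [0] at [0] instead of its limit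
    [j + 2], so no continuity argument applies to it there. Instead
    [r ^+ j.+1 * (r * f r - (j + 1) * m r)] starts at [0] and has derivative
    [r ^+ j.+1 * f r * (1 - p Y)], positive while [Y] is small. *)
Lemma ratZ_near0 {R : realType} {j : nat} {p q : R} {I : set R}
    {u m f v n g : R -> R} (hI : initial_interval I)
    (Hu : half_system j p I u m f v n) (Hv : half_system j q I v n g u m) :
  exists2 d, I d /\ 0 < d & forall r, 0 < r <= d -> j%:R + 1 < ratZ m f r.
Proof.
have I0 := ii_0 hI.
have cY : continuous_at 0 (fun y : R => 1 - p * ratX v n y).
  by have ? := ratX_cont Hv I0; conts.
have [|e e0 he] := cont_near_gt cY (_ : 0 < 1 - p * ratX v n 0).
  by rewrite /ratX mul0r mul0r mulr0 subr0.
have [s Is s0] := ii_open hI I0.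
exists (Num.min s (e / 2)).
  have d0 : 0 < Num.min s (e / 2) by rewrite lt_min s0 divr_gt0.
  by split=> //; apply: (ii_down hI Is (ltW d0)); rewrite ge_min lexx.
move=> r /andP[r0]; rewrite le_min => /andP[rs re].
have sub x : 0 <= x <= r -> I x.
  by move=> /andP[x0 xr]; exact: (ii_down hI Is x0 (le_trans xr rs)).
have Ir : I r by apply: sub; rewrite lexx ltW.
have m0 := slope_gt0 hI Hu Ir r0.
rewrite /ratZ ltr_pdivlMr// -subr_gt0.
have rj : 0 < r ^+ j.+1 by rewrite exprn_gt0.
rewrite -(pmulr_rgt0 _ rj).
have := @segment_lt R (fun y => y ^+ j.+1 * (y * f y - (j%:R + 1) * m y))
  (fun y => y ^+ j.+1 * f y * (1 - p * ratX v n y)) 0 r r0.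
rewrite expr0n mul0r; apply => x.
- by move=> /sub Ix; have ? := hs_m Hu Ix; have ? := hs_f Hu Ix; conts.
- move=> /andP[x0 xr]; have Ix : I x by apply: sub; rewrite !ltW.
  have dm := hs_dm Hu Ix x0; have df := hs_df Hu Ix x0.
  by_derivs.
  rewrite /ratX !exprS -!natr1; field; by rewrite !gt_eqF ?(hs_u0 Hv).
- move=> /andP[x0 xr]; have Ix : I x by apply: sub; rewrite !ltW.
  rewrite mulr_gt0 ?mulr_gt0 ?exprn_gt0 ?(hs_f0 Hu)//.
  by apply: he; rewrite subr0 gtr0_norm//; lra.
Qed.

(* Multiplied by [r ^+ j * u r * v r], this is the Pohozaev energy. *)
Lemma energy_ge0 {R : realType} {j : nat} {p q : R} {I : set R}
    {u m f v n g : R -> R} (hI : initial_interval I)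
    (Hu : half_system j p I u m f v n) (Hv : half_system j q I v n g u m)
    (p0 : 0 < p) (q0 : 0 < q) {a b : R} (ab : a + b = j%:R)
    (ha : a <= (j%:R + 2) / (p + 1)) (hb : b <= (j%:R + 2) / (q + 1)) {r : R} :
  I r -> 0 < r ->
  0 <= ratX u m r * ratX v n r + ratX u m r * ratZ m f r / (p + 1)
       + ratX v n r * ratZ n g r / (q + 1) - a * ratX u m r - b * ratX v n r.
Proof.
move=> Ir r0; have sub x : 0 <= x <= r -> I x.
  by move=> /andP[x0 xr]; exact: (ii_down hI Ir x0 xr).
have p1 : p + 1 != 0 by rewrite gt_eqF// addr_gt0.
have q1 : q + 1 != 0 by rewrite gt_eqF// addr_gt0.
have m0 := slope_gt0 hI Hu Ir r0; have n0 := slope_gt0 hI Hv Ir r0.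
have u0 := hs_u0 Hu Ir; have v0 := hs_u0 Hv Ir.
have uv : 0 < r ^+ j * u r * v r by rewrite !mulr_gt0 ?exprn_gt0.
rewrite -(pmulr_rge0 _ uv).
(* Pohozaev identity: in the derivative, [a + b = j] cancels the [m n] terms, the weights
   [1 / (p + 1)] and [1 / (q + 1)] cancel the [f n] and [g m] terms, and [ha], [hb] make the two
   remaining coefficients nonnegative. *)
have := @segment_le R (fun y => y ^+ j.+1 * (y * (m y * n y
   + f y * v y / (p + 1) + g y * u y / (q + 1)) - a * m y * v y - b * u y * n y))
  (fun y => y ^+ j.+1 * (((j%:R + 2) / (p + 1) - a) * f y * v y
     + ((j%:R + 2) / (q + 1) - b) * g y * u y)) 0 r (ltW r0).
rewrite expr0n mul0r !exprS => E.
rewrite [X in 0 <= X](_ : _ = r * r ^+ j * (r * (m r * n r + f r * v r / (p + 1)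
   + g r * u r / (q + 1)) - a * m r * v r - b * u r * n r)); last first.
  by rewrite /ratX /ratZ; field; rewrite p1 q1 !gt_eqF.
apply: E => x.
- move=> /sub Ix; have ? := hs_m Hu Ix; have ? := hs_f Hu Ix.
  have ? := hs_u Hu Ix; have ? := hs_m Hv Ix; have ? := hs_f Hv Ix.
  by have ? := hs_u Hv Ix; conts.
- move=> /andP[x0 xr]; have Ix : I x by apply: sub; rewrite !ltW.
  have ? := hs_dm Hu Ix x0; have ? := hs_df Hu Ix x0; have ? := hs_du Hu Ix x0.
  have ? := hs_dm Hv Ix x0; have ? := hs_df Hv Ix x0; have ? := hs_du Hv Ix x0.
  by_derivs.
  have -> : b = j%:R - a by rewrite -ab; ring.
  rewrite !exprS -!natr1; field.
  by rewrite p1 q1 !gt_eqF ?(hs_u0 Hv) ?(hs_u0 Hu).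
- move=> /andP[x0 xr]; have Ix : I x by apply: sub; rewrite !ltW.
  apply: mulr_ge0; first by rewrite exprn_ge0 ?ltW.
  apply: addr_ge0; rewrite !mulr_ge0 ?subr_ge0 ?(ltW (hs_u0 _ Ix))//.
  + exact: (ltW (hs_f0 Hu Ix)).
  + exact: (ltW (hs_u0 Hv Ix)).
  + exact: (ltW (hs_f0 Hv Ix)).
  + exact: (ltW (hs_u0 Hu Ix)).
Qed.

(** The energy is taken with [b = (k + 2) / (q + 1)], so that for [w = k + 2 - q x] it is a multiple
    of [x]. Since [y <= q x - 2] and [z <= k - x], the other factor is below
    [(q x - 2) + q (k - x) - k q + 2 = 0]. *)
Lemma no_stationary_exit {R : realType} {p q k x y z w : R} :
  0 < p -> 0 < q -> 1 < p * q -> 0 < x -> 0 < y -> 0 < z ->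
  x + z <= k -> y + w <= k -> w = k + 2 - q * x ->
  0 <= x * y + x * z / (p + 1) + y * w / (q + 1)
       - (k - (k + 2) / (q + 1)) * x - (k + 2) / (q + 1) * y -> False.
Proof.
move=> p0 q0 pq x0 y0 z0 xz yw ew; subst w.
have p1 : 0 < p + 1 by lra.
have q1 : 0 < q + 1 by lra.
rewrite [X in 0 <= X](_ : _ = x / (q + 1) * (y + z * (q + 1) / (p + 1) - k * q + 2));
  last by field; rewrite !gt_eqF.
rewrite pmulr_rge0 ?divr_gt0// => h.
(* The inequality [(q + 1) / (p + 1) < q] is [1 < p q]. *)
have zq : z * (q + 1) / (p + 1) < z * q.
  by rewrite -mulrA ltr_pM2l// ltr_pdivrMr//; lra.
have : q * z <= q * (k - x) by rewrite ler_pM2l//; lra.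
lra.
Qed.

(* [r ^+ j.+1 * n r] is an integrating factor for the logarithmic derivative
   [j + 2 - q X - W] of [W]. *)
Lemma ratZ_slope_deriv {R : realType} {j : nat} {p q : R} {I : set R}
    {u m f v n g : R -> R} (hI : initial_interval I)
    (Hu : half_system j p I u m f v n) (Hv : half_system j q I v n g u m) {r : R} :
  I r -> 0 < r ->
  is_derive r 1
    (fun y => y ^+ j.+1 * ((j%:R + 2) * n y - q * (y * m y / u y) * n y - y * g y))
    (- (q * ratX u m r * (ratX u m r + ratZ m f r - j%:R) * r ^+ j * n r)).
Proof.
move=> Ir r0; have ? := hs_dm Hu Ir r0; have ? := hs_du Hu Ir r0.
have ? := hs_dm Hv Ir r0; have ? := hs_df Hv Ir r0.
have u0 : u r != 0 by rewrite gt_eqF// (hs_u0 Hu).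
have m0 : m r != 0 by rewrite gt_eqF// (slope_gt0 hI Hu).
by_derivs; rewrite /ratX /ratZ !exprS -!natr1; field.
by rewrite u0 m0 gt_eqF.
Qed.

Lemma ratZ_slope_cont {R : realType} {j : nat} {p q : R} {I : set R}
    {u m f v n g : R -> R}
    (Hu : half_system j p I u m f v n) (Hv : half_system j q I v n g u m) {r : R} :
  I r -> continuous_at r
    (fun y => y ^+ j.+1 * ((j%:R + 2) * n y - q * (y * m y / u y) * n y - y * g y)).
Proof.
move=> Ir; have ? := hs_m Hu Ir; have ? := hs_u Hu Ir.
have ? := hs_m Hv Ir; have ? := hs_f Hv Ir.
have u0 : u r != 0 by rewrite gt_eqF// (hs_u0 Hu).
conts.
Qed.

Lemma ratZ_slopeE {R : realType} {j : nat} {q : R} {u m n g : R -> R} {r : R} :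
  n r != 0 ->
  r ^+ j.+1 * ((j%:R + 2) * n r - q * (r * m r / u r) * n r - r * g r) =
  (j%:R + 2 - q * ratX u m r - ratZ n g r) * (r ^+ j.+1 * n r).
Proof. by move=> n0; rewrite /ratX /ratZ; move: (r * m r / u r) => x; field. Qed.

(** Multiplied by the integrating factor, the rate vanishes at [0] and has a negative derivative as
    long as [X] increases, so no limit of [W] at the centre is involved. *)
Lemma ratZ_decreasing_until {R : realType} {j : nat} {p q : R} {I : set R}
    {u m f v n g : R -> R} (hI : initial_interval I)
    (Hu : half_system j p I u m f v n) (Hv : half_system j q I v n g u m)
    (q0 : 0 < q) {r : R} : I r -> 0 < r ->
  (forall s, 0 < s < r -> 0 < ratX u m s + ratZ m f s - j%:R) ->
  j%:R + 2 - q * ratX u m r - ratZ n g r < 0.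
Proof.
move=> Ir r0 hA; have sub x : 0 <= x <= r -> I x.
  by move=> /andP[x0 xr]; exact: (ii_down hI Ir x0 xr).
have n0 := slope_gt0 hI Hv Ir r0.
have kn : 0 < r ^+ j.+1 * n r by rewrite mulr_gt0 ?exprn_gt0.
rewrite -(pmulr_llt0 _ kn) -ratZ_slopeE ?gt_eqF//.
have := @segment_gt R
  (fun y => y ^+ j.+1 * ((j%:R + 2) * n y - q * (y * m y / u y) * n y - y * g y))
  (fun y => - (q * ratX u m y * (ratX u m y + ratZ m f y - j%:R) * y ^+ j * n y))
  0 r r0.
rewrite expr0n mul0r; apply => x.
- by move=> /sub Ix; exact: (ratZ_slope_cont Hu Hv Ix).
- move=> /andP[x0 xr]; have Ix : I x by apply: sub; rewrite !ltW.
  exact: (ratZ_slope_deriv hI Hu Hv Ix x0).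
- move=> /andP[x0 xr]; have Ix : I x by apply: sub; rewrite !ltW.
  have hX := ratX_gt0 hI Hu Ix x0; have hn := slope_gt0 hI Hv Ix x0.
  have hx : 0 < x ^+ j by exact: exprn_gt0.
  have hAx : 0 < ratX u m x + ratZ m f x - j%:R by apply: hA; rewrite x0.
  by rewrite oppr_lt0; do 4!(apply: mulr_gt0 => //).
Qed.

Lemma source_decreasing {R : realType} {j : nat} {p q : R} {I : set R}
    {u m f v n g : R -> R} (hI : initial_interval I)
    (Hu : half_system j p I u m f v n) (Hv : half_system j q I v n g u m)
    (p0 : 0 <= p) {r s : R} : I s -> 0 <= r -> r <= s -> f s <= f r.
Proof.
move=> Is r0 rs.
have Ix x : r <= x <= s -> I x.
  by move=> /andP[rx xs]; exact: (ii_down hI Is (le_trans r0 rx) xs).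
apply: (@segment_ge R f (fun x => - (p * f x * n x / v x)) r s rs) => x.
- by move=> /Ix /(hs_f Hu).
- move=> /andP[rx xs]; have x0 := le_lt_trans r0 rx.
  by apply: (hs_df Hu) => //; apply: Ix; rewrite !ltW.
- move=> /andP[rx xs]; have x0 := le_lt_trans r0 rx.
  have Ix' : I x by apply: Ix; rewrite !ltW.
  have n0 := ltW (slope_gt0 hI Hv Ix' x0); have v0 := ltW (hs_u0 Hv Ix').
  by have f0 := ltW (hs_f0 Hu Ix'); rewrite oppr_le0 divr_ge0 ?mulr_ge0.
Qed.

(** * What happens if [Y] stops increasing first *)

Section exit.
Context {R : realType} {j : nat} {p q : R} {I : set R} {u m f v n g : R -> R}.
Hypothesis hI : initial_interval I.
Hypothesis Hu : half_system j p I u m f v n.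
Hypothesis Hv : half_system j q I v n g u m.
Hypotheses (p0 : 0 < p) (q0 : 0 < q) (pq : 1 < p * q).
Hypothesis sub_hyperbola : j%:R - (j%:R + 2) / (q + 1) <= (j%:R + 2) / (p + 1).

Let X := ratX u m.
Let Y := ratX v n.
Let Z := ratZ m f.
Let W := ratZ n g.
(** [A], [B] and [D] are the logarithmic growth rates of [X], [Y] and [W] in the variable [ln r];
    [K] is [D] times its integrating factor. *)
Let A y := X y + Z y - j%:R.
Let B y := Y y + W y - j%:R.
Let D y := j%:R + 2 - q * X y - W y.
Let K y := y ^+ j.+1 * ((j%:R + 2) * n y - q * (y * m y / u y) * n y - y * g y).
(** This is [v B]. The factor [v] cancels the term [Y B] in the derivative of [B], which leaves a
    derivative with the sign of [D]. *)
Let L y := y * n y + y * g y * v y / n y - j%:R * v y.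

Let sub {a b x} : I b -> 0 < a -> a <= x <= b -> I x /\ 0 < x.
Proof.
move=> Ib a0 /andP[ax xb]; have x0 := lt_le_trans a0 ax.
by split=> //; exact: (ii_down hI Ib (ltW x0) xb).
Qed.

Let K_lt0 {x} : I x -> 0 < x -> (K x < 0) = (D x < 0).
Proof.
move=> Ix x0; have n0 := slope_gt0 hI Hv Ix x0.
by rewrite /K ratZ_slopeE ?gt_eqF// pmulr_llt0// mulr_gt0 ?exprn_gt0.
Qed.

Let LE {x} : I x -> 0 < x -> L x = v x * B x.
Proof.
move=> Ix x0; have n0 := slope_gt0 hI Hv Ix x0; have v0 := hs_u0 Hv Ix.
by rewrite /L /B /Y /W /ratX /ratZ; field; rewrite !gt_eqF.
Qed.

Let L_deriv {x} : I x -> 0 < x -> is_derive x 1 L (v x * W x * D x / x).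
Proof.
move=> Ix x0; have n0 := slope_gt0 hI Hv Ix x0; have v0 := hs_u0 Hv Ix.
have nn : n x != 0 by rewrite gt_eqF.
have u0 := hs_u0 Hu Ix.
have ? := hs_dm Hv Ix x0; have ? := hs_df Hv Ix x0; have ? := hs_du Hv Ix x0.
rewrite /L; by_derivs; rewrite /D /X /W /ratX /ratZ -!natr1; field.
by rewrite !gt_eqF.
Qed.

Let L_decr {a b} : I b -> 0 < a -> a < b ->
  (forall x, a < x < b -> D x < 0) -> L b < L a.
Proof.
move=> Ib a0 ab hD.
apply: (@segment_gt R L (fun x => v x * W x * D x / x) a b ab) => x hx.
- have [Ix x0] := sub Ib a0 hx.
  exact: (deriv_cont (L_deriv Ix x0)).
- have [Ix x0] : I x /\ 0 < x.
    by apply: (sub Ib a0); move/andP: hx => [? ?]; rewrite !ltW.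
  exact: L_deriv.
- have [Ix x0] : I x /\ 0 < x.
    by apply: (sub Ib a0); move/andP: hx => [? ?]; rewrite !ltW.
  rewrite pmulr_llt0 ?invr_gt0// pmulr_rlt0 ?hD//.
  by rewrite mulr_gt0 ?(hs_u0 Hv)//; exact: (ratZ_gt0 hI Hv Ix x0).
Qed.

(** The energy is used with [b] as large as allowed, [(j + 2) / (q + 1)]; the bound on [a = j - b]
    is then exactly [sub_hyperbola]. *)
Let D_neq0 {x} : I x -> 0 < x -> A x <= 0 -> B x <= 0 -> D x != 0.
Proof.
move=> Ix x0 hA hB; apply/eqP => hD.
apply: (@no_stationary_exit R p q j%:R (X x) (Y x) (Z x) (W x)) => //.
- exact: (ratX_gt0 hI Hu Ix x0).
- exact: (ratX_gt0 hI Hv Ix x0).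
- exact: (ratZ_gt0 hI Hu Ix x0).
- by rewrite -subr_le0.
- by rewrite -subr_le0.
- by move: hD; rewrite /D; lra.
- exact: (energy_ge0 hI Hu Hv p0 q0 (subrK _ _) sub_hyperbola (lexx _) Ix x0).
Qed.

(** At a first zero [s] of [D] after [t], [B] is still negative because [L] has decreased, so
    [D_neq0] forces [A s > 0]. Then [K] is strictly decreasing just before [s], hence positive there
    as [K s = 0], against the choice of [s]. *)
Lemma locked_after_exit {t} : I t -> 0 < t -> D t < 0 -> B t <= 0 ->
  forall r, I r -> t <= r -> D r < 0.
Proof.
move=> It t0 Dt Bt r Ir tr; rewrite ltNge; apply/negP => Dr.
have cK x : t <= x <= r -> continuous_at x (fun y => 0 - K y).
  move=> /(sub Ir t0)[Ix x0].
  by apply: contB; [exact: contC | exact: (ratZ_slope_cont Hu Hv Ix)].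
have := first_nonpos tr cK; rewrite sub0r oppr_gt0 K_lt0// => /(_ Dt).
have r0 := lt_le_trans t0 tr.
rewrite sub0r oppr_le0 leNgt K_lt0// -leNgt => /(_ Dr)[s /andP[ts sr]].
rewrite sub0r => -[/eqP]; rewrite oppr_eq0 => /eqP Ks hs.
have [Is s0] : I s /\ 0 < s by apply: (sub Ir t0); rewrite ltW.
have hD x : t < x < s -> D x < 0.
  move=> /andP[tx xs]; have [Ix x0] : I x /\ 0 < x.
    by apply: (sub Is t0); rewrite !ltW.
  by rewrite -K_lt0// -oppr_gt0 -sub0r; apply: hs; rewrite xs ltW.
have Bs : B s < 0.
  rewrite -(pmulr_rlt0 _ (hs_u0 Hv Is)) -LE//.
  apply: (lt_le_trans (L_decr Is t0 ts hD)).
  by rewrite LE// pmulr_rle0 ?(hs_u0 Hv).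
have n0 := slope_gt0 hI Hv Is s0.
have Ds : D s = 0.
  move: Ks; rewrite /K ratZ_slopeE ?gt_eqF// => /eqP.
  by rewrite mulf_eq0 (gt_eqF (_ : 0 < _ * _)) ?mulr_gt0 ?exprn_gt0// orbF => /eqP.
have As : 0 < A s.
  rewrite ltNge; apply/negP => hA; have := D_neq0 Is s0 hA (ltW Bs).
  by rewrite Ds eqxx.
have cA : continuous_at s A.
  have ? := hs_m Hu Is; have ? := hs_f Hu Is; have ? := hs_u Hu Is.
  have ? : u s != 0 by rewrite gt_eqF ?(hs_u0 Hu).
  have ? : m s != 0 by rewrite gt_eqF// (slope_gt0 hI Hu).
  by rewrite /A /X /Z /ratX /ratZ; conts.
have [d d0 hd] := cont_near_gt cA As.
(* A point of [[t, s[] so close to [s] that [A] is positive from [x] to [s]. *)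
pose x := Num.max t (s - d / 2).
have xs : x < s by rewrite gt_max ts ltrBlDr ltrDl divr_gt0.
have tx : t <= x by rewrite le_max lexx.
have dx : s - d / 2 <= x by rewrite le_max lexx orbT.
have : K x < 0 by rewrite -oppr_gt0 -sub0r; apply: hs; rewrite tx.
apply/negP; rewrite -leNgt.
have x0 := lt_le_trans t0 tx.
rewrite -Ks; apply: ltW.
apply: (@segment_gt R K
  (fun y => - (q * X y * (X y + Z y - j%:R) * y ^+ j * n y)) x s xs) => y.
- move=> /andP[xy ys]; have [Iy y0] : I y /\ 0 < y.
    by apply: (sub Ir t0); rewrite (le_trans tx xy) (le_trans ys sr).
  exact: (ratZ_slope_cont Hu Hv Iy).
- move=> /andP[xy ys]; have [Iy y0] : I y /\ 0 < y.
    by apply: (sub Is x0); rewrite !ltW.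
  exact: (ratZ_slope_deriv hI Hu Hv Iy y0).
- move=> /andP[xy ys]; have [Iy y0] : I y /\ 0 < y.
    by apply: (sub Is x0); rewrite !ltW.
  have hX : 0 < X y := ratX_gt0 hI Hu Iy y0.
  have hn := slope_gt0 hI Hv Iy y0.
  have hy : 0 < y ^+ j by exact: exprn_gt0.
  have hA : 0 < A y by apply: hd; rewrite ltr0_norm ?subr_lt0//; lra.
  by rewrite oppr_lt0; do 4!(apply: mulr_gt0 => //).
Qed.

(* Once [Y] starts to decrease it decreases forever, so fast that [p Y], the
   logarithmic derivative of [1 / f] in [ln r], is integrable. *)
Lemma source_bounded_below {t} : I t -> 0 < t -> D t < 0 -> B t <= 0 ->
  exists2 c, 0 < c & forall r, I r -> c <= f r.
Proof.
move=> It t0 Dt Bt; have locked := locked_after_exit It t0 Dt Bt.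
(* [B] may vanish at [t], but it is negative at any later [s], and [- B s] serves as decay rate of
   [Y]. *)
have [s Is ts] := ii_open hI It.
have s0 := lt_trans t0 ts.
have Blt r : I r -> t < r -> B r < 0.
  move=> Ir tr; have r0 := lt_trans t0 tr.
  rewrite -(pmulr_rlt0 _ (hs_u0 Hv Ir)) -LE//.
  apply: (@lt_le_trans _ _ (L t)); last by rewrite LE// pmulr_rle0 ?(hs_u0 Hv).
  apply: L_decr => // x /andP[tx xr].
  have [Ix x0] : I x /\ 0 < x by apply: (sub Ir t0); rewrite !ltW.
  by apply: locked => //; exact: ltW.
have Y_deriv x : I x -> 0 < x -> is_derive x 1 Y (Y x * B x / x).
  exact: (ratX_deriv hI Hv).
have W_deriv x : I x -> 0 < x -> is_derive x 1 W (W x * D x / x).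
  by move=> Ix x0; apply: (ratZ_deriv hI Hv) => //; rewrite gt_eqF// (hs_u0 Hu).
have pos x : I x -> 0 < x -> 0 < Y x /\ 0 < W x.
  by move=> Ix x0; split; [exact: (ratX_gt0 hI Hv Ix x0)|exact: (ratZ_gt0 hI Hv Ix x0)].
have Bs r : I r -> s <= r -> B r <= B s.
  move=> Ir sr; apply: (@segment_ge R (fun y => Y y + W y - j%:R)
    (fun x => Y x * B x / x + W x * D x / x - 0) s r sr) => x.
  - move=> /(sub Ir s0)[Ix x0].
    have ? := deriv_cont (Y_deriv x Ix x0); have ? := deriv_cont (W_deriv x Ix x0).
    by conts.
  - move=> /andP[sx xr]; have [Ix x0] : I x /\ 0 < x.
      by apply: (sub Ir s0); rewrite !ltW.
    by have ? := Y_deriv x Ix x0; have ? := W_deriv x Ix x0; derivs.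
  - move=> /andP[sx xr]; have [Ix x0] : I x /\ 0 < x.
      by apply: (sub Ir s0); rewrite !ltW.
    have [Y0 W0] := pos x Ix x0; have tx := lt_trans ts sx.
    rewrite subr0 -mulrDl pmulr_lle0 ?invr_gt0//.
    have YB : Y x * B x < 0 by rewrite pmulr_rlt0// Blt.
    have WD : W x * D x < 0 by rewrite pmulr_rlt0//; apply: locked; rewrite // ltW.
    by lra.
pose e := - B s.
have e0 : 0 < e by rewrite oppr_gt0 Blt.
(* In [ln r] the derivative is [p Y (B + e)], and [B <= - e] after [s]. Dropping the positive
   [p Y r] bounds [ln (f r)] from below. *)
have H r : I r -> s <= r -> p * Y r - e * ln (f r) <= p * Y s - e * ln (f s).
  move=> Ir sr; apply: (@segment_ge R (fun y => p * Y y - e * ln (f y))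
    (fun x => p * Y x * (B x - B s) / x) s r sr).
  - move=> x /(sub Ir s0)[Ix x0]; have ? := deriv_cont (Y_deriv x Ix x0).
    have ? := deriv_cont (derivln (hs_f0 Hu Ix) (hs_df Hu Ix x0)).
    by conts.
  - move=> x /andP[sx xr]; have [Ix x0] : I x /\ 0 < x.
      by apply: (sub Ir s0); rewrite !ltW.
    have ? := Y_deriv x Ix x0; have f0 := hs_f0 Hu Ix; have ? := hs_df Hu Ix x0.
    by_derivs; rewrite /e /Y /ratX; field; rewrite !gt_eqF//.
    exact: (hs_u0 Hv Ix).
  - move=> x /andP[sx xr]; have [Ix x0] : I x /\ 0 < x.
      by apply: (sub Ir s0); rewrite !ltW.
    have [Y0 W0] := pos x Ix x0.
    have pY : 0 < p * Y x by exact: mulr_gt0.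
    rewrite pmulr_lle0 ?invr_gt0// pmulr_rle0//.
    by rewrite subr_le0 Bs// ltW.
pose c := expR (- (p * Y s - e * ln (f s)) / e).
have cf r : I r -> s <= r -> c <= f r.
  move=> Ir sr; have f0 := hs_f0 Hu Ir.
  have r0 := lt_le_trans s0 sr; have [Y0 _] := pos r Ir r0.
  rewrite -[f r]lnK ?posrE// ler_expR ler_pdivrMr//.
  have pY : 0 < p * Y r by exact: mulr_gt0.
  by have := H r Ir sr; lra.
exists c => [|r Ir]; first exact: expR_gt0.
have [sr|rs] := leP s r; first exact: cf.
apply: (le_trans (cf s Is (lexx s))).
exact: (source_decreasing hI Hu Hv (ltW p0) Is (ii_ge0 hI Ir) (ltW rs)).
Qed.

(** While [A] is positive, [D] is negative; [B t <= 0] would then bound [f] away from zero. That [f]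
    takes arbitrarily small values is the common consequence of the boundary condition and of the
    whole-space setting. *)
Lemma no_exit {t} : (forall c, 0 < c -> exists2 r, I r & f r < c) ->
  I t -> 0 < t -> (forall s, 0 < s < t -> 0 < A s) -> 0 < B t.
Proof.
move=> hf It t0 hA; rewrite ltNge; apply/negP => Bt.
have Dt := ratZ_decreasing_until hI Hu Hv q0 It t0 hA.
have [c c0 hc] := source_bounded_below It t0 Dt Bt.
by have [r Ir] := hf c c0; rewrite ltNge hc.
Qed.

End exit.

(** * Monotonicity of the ratios and the sign change of the curvature *)

(** Both rates are positive near [0], where [Z] and [W] exceed [j + 1]. Whichever rate vanishes
    first does so while the other has been positive, and [no_exit], used in both orders of [u] and
    [v], forbids it. *)
Lemma ratX_growth_gt0 {R : realType} {j : nat} {p q : R} {I : set R}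
    {u m f v n g : R -> R} (hI : initial_interval I)
    (Hu : half_system j p I u m f v n) (Hv : half_system j q I v n g u m)
    (p0 : 0 < p) (q0 : 0 < q) (pq : 1 < p * q)
    (hyp : j%:R - (j%:R + 2) / (q + 1) <= (j%:R + 2) / (p + 1))
    (hf : forall c, 0 < c -> exists2 r, I r & f r < c)
    (hg : forall c, 0 < c -> exists2 r, I r & g r < c) {r : R} :
  I r -> 0 < r -> 0 < ratX v n r + ratZ n g r - j%:R.
Proof.
move=> Ir r0.
pose A y := ratX u m y + ratZ m f y - j%:R.
pose B y := ratX v n y + ratZ n g y - j%:R.
have qp : 1 < q * p by rewrite mulrC.
have hyp' : j%:R - (j%:R + 2) / (p + 1) <= (j%:R + 2) / (q + 1).
  by move: hyp; rewrite !lerBlDr addrC.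
have exitB t := @no_exit _ _ _ _ _ _ _ _ _ _ _ hI Hu Hv p0 q0 pq hyp t hf.
have exitA t := @no_exit _ _ _ _ _ _ _ _ _ _ _ hI Hv Hu q0 p0 qp hyp' t hg.
have [a [Ia a0] ha] := ratZ_near0 hI Hu Hv.
have [b [Ib b0] hb] := ratZ_near0 hI Hv Hu.
pose d := Num.min a b.
have d0 : 0 < d by rewrite lt_min a0.
have dd : 0 < d <= d by rewrite d0 lexx.
have nearA y : 0 < y <= d -> 0 < A y.
  move=> /andP[y0]; rewrite le_min => /andP[ya yb].
  have Iy := ii_down hI Ia (ltW y0) ya.
  have := ratX_gt0 hI Hu Iy y0; have := ha y; rewrite y0 ya => /(_ isT).
  by rewrite /A; lra.
have nearB y : 0 < y <= d -> 0 < B y.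
  move=> /andP[y0]; rewrite le_min => /andP[ya yb].
  have Iy := ii_down hI Ia (ltW y0) ya.
  have := ratX_gt0 hI Hv Iy y0; have := hb y; rewrite y0 yb => /(_ isT).
  by rewrite /B; lra.
have cA y : I y -> 0 < y -> continuous_at y A.
  move=> Iy y0; have ? := deriv_cont (ratX_deriv hI Hu Iy y0).
  have v0 : v y != 0 by rewrite gt_eqF// (hs_u0 Hv).
  by have ? := deriv_cont (ratZ_deriv hI Hu v0 Iy y0); rewrite /A; conts.
have cB y : I y -> 0 < y -> continuous_at y B.
  move=> Iy y0; have ? := deriv_cont (ratX_deriv hI Hv Iy y0).
  have u0 : u y != 0 by rewrite gt_eqF// (hs_u0 Hu).
  by have ? := deriv_cont (ratZ_deriv hI Hv u0 Iy y0); rewrite /B; conts.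
have sub x y : I y -> d <= x <= y -> I x /\ 0 < x.
  move=> Iy /andP[dx xy]; have x0 := lt_le_trans d0 dx.
  by split=> //; exact: (ii_down hI Iy (ltW x0) xy).
rewrite -/(B r) ltNge; apply/negP => Br.
have dr : d <= r.
  rewrite leNgt; apply/negP => rd; have := nearB r.
  by rewrite r0 ltW// ltNge Br => /(_ isT).
have [t /andP[dt tr] [Bt ht]] := first_nonpos dr
  (fun x hx => cB x (sub x r Ir hx).1 (sub x r Ir hx).2) (nearB d dd) Br.
have [It t0] : I t /\ 0 < t by apply: (sub t r Ir); rewrite ltW.
have posB s : 0 < s < t -> 0 < B s.
  move=> /andP[s0 st]; have [ds|sd] := leP d s; first by apply: ht; rewrite ds.
  by apply: nearB; rewrite s0 ltW.
(* If [A] were positive up to [t], [exitB] would contradict [B t = 0]; so [A] vanishes before [B],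
   and [exitA] applies at its first zero [w]. *)
have [s hs As] : exists2 s, 0 < s < t & A s <= 0.
  apply: contrapT => hn; have : 0 < B t; last by rewrite Bt ltxx.
  apply: (exitB t It t0) => s hs; rewrite ltNge; apply/negP => As.
  by apply: hn; exists s.
have [s0 st] := andP hs.
have Is := ii_down hI It (ltW s0) (ltW st).
have ds : d <= s.
  rewrite leNgt; apply/negP => sd; have := nearA s.
  by rewrite s0 ltW// ltNge As => /(_ isT).
have [w /andP[dw ws] [Aw hw]] := first_nonpos ds
  (fun x hx => cA x (sub x s Is hx).1 (sub x s Is hx).2) (nearA d dd) As.
have [Iw w0] : I w /\ 0 < w by apply: (sub w s Is); rewrite ltW.
have : 0 < A w; last by rewrite Aw ltxx.
apply: (exitA w Iw w0) => x /andP[x0 xw]; apply: posB.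
by rewrite x0 (lt_trans xw) ?(le_lt_trans ws).
Qed.

(** If [Z] stayed above [j + 1], then [m' > 0], so [u] would lie below a line of slope [- m d] and
    the interval would be bounded. But then [r f > (j + 1) m] keeps [f] away from zero. *)
Lemma ratZ_drops {R : realType} {j : nat} {p q : R} {I : set R}
    {u m f v n g : R -> R} (hI : initial_interval I)
    (Hu : half_system j p I u m f v n) (Hv : half_system j q I v n g u m)
    (p0 : 0 < p) (hf : forall c, 0 < c -> exists2 r, I r & f r < c) {d : R} :
  I d -> 0 < d -> exists2 r, I r /\ d <= r & ratZ m f r <= j%:R + 1.
Proof.
move=> Id d0; apply: contrapT => hn.
have hZ r : I r -> d <= r -> j%:R + 1 < ratZ m f r.
  by move=> Ir dr; rewrite ltNge; apply/negP => Zr; apply: hn; exists r.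
have sub x y : I y -> d <= x <= y -> I x /\ 0 < x.
  move=> Iy /andP[dx xy]; have x0 := lt_le_trans d0 dx.
  by split=> //; exact: (ii_down hI Iy (ltW x0) xy).
have md := slope_gt0 hI Hu Id d0.
have mm r : I r -> d <= r -> m d <= m r.
  move=> Ir dr; apply: (@segment_le R m (fun x => f x - j.+1%:R * m x / x) d r dr) => x.
  - by move=> /(sub _ _ Ir)[Ix x0]; exact: (hs_m Hu).
  - move=> /andP[dx xr]; have [Ix x0] : I x /\ 0 < x.
      by apply: (sub _ _ Ir); rewrite !ltW.
    exact: (hs_dm Hu).
  - move=> /andP[dx xr]; have [Ix x0] : I x /\ 0 < x.
      by apply: (sub _ _ Ir); rewrite !ltW.
    have mx := slope_gt0 hI Hu Ix x0.
    have := hZ x Ix (ltW dx); rewrite /ratZ ltr_pdivlMr// => h.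
    by rewrite subr_ge0 ler_pdivrMr// -natr1 mulrC [f x * x]mulrC ltW// mulrC.
have uu r : I r -> d <= r -> u r + r * m d <= u d + d * m d.
  move=> Ir dr; apply: (@segment_ge R (fun y => u y + y * m d)
    (fun x => - m x + m d) d r dr) => x.
  - by move=> /(sub _ _ Ir)[Ix x0]; have ? := hs_u Hu Ix; conts.
  - move=> /andP[dx xr]; have [Ix x0] : I x /\ 0 < x.
      by apply: (sub _ _ Ir); rewrite !ltW.
    by have ? := hs_du Hu Ix x0; by_derivs; ring.
  - move=> /andP[dx xr]; have [Ix x0] : I x /\ 0 < x.
      by apply: (sub _ _ Ir); rewrite !ltW.
    by have := mm x Ix (ltW dx); lra.
(* The radius at which the line through [(d, u d)] of slope [- m d] reaches zero. *)
pose M := d + u d / m d.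
have M0 : 0 < M by rewrite addr_gt0 ?divr_gt0 ?(hs_u0 Hu).
have rM r : I r -> d <= r -> r <= M.
  move=> Ir dr; have := uu r Ir dr; have := hs_u0 Hu Ir => u0 h.
  rewrite -(ler_pM2l md) /M mulrDr mulrCA divff ?gt_eqF// mulr1; lra.
pose c := (j%:R + 1) * m d / M.
have j0 : 0 < j%:R + 1 :> R by rewrite natr1 ltr0n.
have c0 : 0 < c by rewrite divr_gt0 ?mulr_gt0.
have fc r : I r -> d <= r -> c < f r.
  move=> Ir dr; have r0 := lt_le_trans d0 dr.
  have := hZ r Ir dr; rewrite /ratZ ltr_pdivlMr ?(slope_gt0 hI Hu)// => h.
  rewrite /c ltr_pdivrMr//.
  have h1 : (j%:R + 1) * m d <= (j%:R + 1) * m r by rewrite ler_pM2l// mm.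
  have h2 : r * f r <= f r * M by rewrite mulrC ler_pM2l ?(hs_f0 Hu)// rM.
  by apply: le_lt_trans h1 _; exact: lt_le_trans h h2.
have [r Ir] := hf c c0; apply/negP; rewrite -leNgt ltW//.
have [dr|rd] := leP d r; first exact: fc.
apply: lt_le_trans (fc d Id (lexx d)) _.
exact: (source_decreasing hI Hu Hv (ltW p0) Id (ii_ge0 hI Ir) (ltW rd)).
Qed.

(** Each factor is [u''], written as [(m / r) (j + 1 - Z)], and [Z] crosses [j + 1] once, being
    strictly decreasing. *)
Lemma curvature_sign_change {R : realType} {j : nat} {p q : R} {I : set R}
    {u m f v n g : R -> R} (hI : initial_interval I)
    (Hu : half_system j p I u m f v n) (Hv : half_system j q I v n g u m)
    (p0 : 0 < p) (q0 : 0 < q) (pq : 1 < p * q)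
    (hyp : j%:R - (j%:R + 2) / (q + 1) <= (j%:R + 2) / (p + 1))
    (hf : forall c, 0 < c -> exists2 r, I r & f r < c)
    (hg : forall c, 0 < c -> exists2 r, I r & g r < c) :
  exists2 c, I c /\ 0 < c & forall r s, I r -> 0 < r -> I s -> r < c -> c < s ->
    (j.+1%:R * m r / r - f r) * (j.+1%:R * m s / s - f s) < 0.
Proof.
have Zd y : I y -> 0 < y -> is_derive y 1 (ratZ m f)
    (ratZ m f y * (j%:R + 2 - p * ratX v n y - ratZ m f y) / y).
  by move=> Iy y0; apply: (ratZ_deriv hI Hu) => //; rewrite gt_eqF// (hs_u0 Hv).
have Zdecr a b : 0 < a -> I b -> a < b -> ratZ m f b < ratZ m f a.
  move=> a0 Ib ab.
  have sub x : a <= x <= b -> I x /\ 0 < x.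
    move=> /andP[ax xb]; have x0 := lt_le_trans a0 ax.
    by split=> //; exact: (ii_down hI Ib (ltW x0) xb).
  apply: (@segment_gt R (ratZ m f) (fun y =>
    ratZ m f y * (j%:R + 2 - p * ratX v n y - ratZ m f y) / y) a b ab) => x.
  - by move=> /sub[Ix x0]; exact: (deriv_cont (Zd x Ix x0)).
  - move=> /andP[ax xb]; have [Ix x0] : I x /\ 0 < x by apply: sub; rewrite !ltW.
    exact: Zd.
  - move=> /andP[ax xb]; have [Ix x0] : I x /\ 0 < x by apply: sub; rewrite !ltW.
    have Z0 := ratZ_gt0 hI Hu Ix x0.
    rewrite pmulr_llt0 ?invr_gt0// pmulr_rlt0//.
    (* With [u] and [v] exchanged: the growth of [Y] makes [Z] decrease. *)
    apply: (ratZ_decreasing_until hI Hv Hu p0 Ix x0) => s /andP[s0 sx].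
    apply: (ratX_growth_gt0 hI Hu Hv) => //.
    exact: (ii_down hI Ix (ltW s0) (ltW sx)).
have [d [Id d0] hd] := ratZ_near0 hI Hu Hv.
have [r [Ir dr] hr] := ratZ_drops hI Hu Hv p0 hf Id d0.
have [c /andP[dc cr] [hc _]] : exists2 c, d < c <= r &
    ratZ m f c - (j%:R + 1) = 0 /\
    forall s, d <= s < c -> 0 < ratZ m f s - (j%:R + 1).
  apply: first_nonpos => //.
  - move=> x /andP[dx xr]; have x0 := lt_le_trans d0 dx.
    have ? := deriv_cont (Zd x (ii_down hI Ir (ltW x0) xr) x0).
    by conts.
  - by rewrite subr_gt0 hd// d0 lexx.
  - by rewrite subr_le0.
have c0 := lt_trans d0 dc.
have Ic := ii_down hI Ir (ltW c0) cr.
have curvE y : I y -> 0 < y ->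
    j.+1%:R * m y / y - f y = m y / y * (j%:R + 1 - ratZ m f y).
  move=> Iy y0; have m0 := slope_gt0 hI Hu Iy y0.
  by rewrite /ratZ -natr1; field; rewrite !gt_eqF.
exists c => // x y Ix x0 Iy xc cy.
have y0 := lt_trans c0 cy.
have mx := slope_gt0 hI Hu Ix x0; have my := slope_gt0 hI Hu Iy y0.
have Zx := Zdecr x c x0 Ic xc; have Zy := Zdecr c y c0 Iy cy.
rewrite !curvE// pmulr_llt0; last by rewrite mulr_gt0 ?divr_gt0//; lra.
by rewrite pmulr_rlt0 ?divr_gt0//; lra.
Qed.

(** * Radial functions along a coordinate axis *)

Lemma line_deriv {R : realType} {N : nat} {w : 'rV[R]_N -> R} {x e : 'rV[R]_N}
    {t : R} :
  derivable w (x + t *: e) e ->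
  is_derive t 1 (fun s => w (x + s *: e)) ('D_e w (x + t *: e)).
Proof.
move=> dw.
have E : (fun h : R => h^-1 *: (((fun s => w (x + s *: e)) \o shift t) (h *: 1)
      - w (x + t *: e)))
    = (fun h : R => h^-1 *: ((w \o shift (x + t *: e)) (h *: e) - w (x + t *: e))).
  apply: funext => h /=; congr (_ *: (w _ - _)).
  by rewrite [h%:A]mulr1 scalerDl addrCA.
by split; rewrite /derivable /derive E.
Qed.

Lemma enorm_line {R : realType} {N : nat} {i k : 'I_N} (r h : R) : i != k ->
  enorm (r *: delta_mx ord0 k + h *: delta_mx ord0 i) = Num.sqrt (r ^+ 2 + h ^+ 2).
Proof.
move=> ik; rewrite /enorm; congr Num.sqrt.
rewrite (bigD1 k)//= (bigD1 i)//= big1 ?addr0 => [|l /andP[lk li]]; rewrite !mxE.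
  by rewrite !eqxx /= eq_sym (negbTE ik) /= !mulr1 !mulr0 addr0 add0r.
by rewrite eqxx /= (negbTE lk) (negbTE li) !mulr0 addr0 expr0n.
Qed.

Lemma enorm_axis {R : realType} {N : nat} (k : 'I_N) (r : R) :
  enorm (r *: delta_mx ord0 k) = `|r|.
Proof.
rewrite -sqrtr_sqr /enorm; congr Num.sqrt.
rewrite (bigD1 k)//= big1 ?addr0 => [|l lk]; rewrite !mxE.
  by rewrite !eqxx mulr1.
by rewrite eqxx /= (negbTE lk) mulr0 expr0n.
Qed.

(** Covers the whole space and the open balls: membership is governed by the norm, and no norm is
    the largest. *)
Definition ball_like {R : realType} {N : nat} (Omega : set 'rV[R]_N) :=
  [/\ Omega 0, forall x y, Omega x -> enorm y <= enorm x -> Omega y &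
      forall x, Omega x -> exists2 y, Omega y & enorm x < enorm y].

Definition radii {R : realType} {N : nat} (Omega : set 'rV[R]_N) : set R :=
  [set r | 0 <= r /\ exists2 x, Omega x & enorm x = r].

Lemma ball_like_mem {R : realType} {N : nat} {Omega : set 'rV[R]_N} {x : 'rV[R]_N} :
  ball_like Omega -> radii Omega (enorm x) -> Omega x.
Proof. by move=> [_ sub _] [_ [y Oy e]]; apply: sub Oy _; rewrite e. Qed.

Lemma radii_interval {R : realType} {N : nat} {Omega : set 'rV[R]_N} (k : 'I_N) :
  ball_like Omega -> initial_interval (radii Omega).
Proof.
move=> [mem0 sub up]; split.
- by move=> r [].
- move=> r s [r0 [x Ox xr]] s0 sr; split=> //.
  have ns : enorm (s *: delta_mx ord0 k : 'rV[R]_N) = s by rewrite enorm_axis ger0_norm.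
  by exists (s *: delta_mx ord0 k) => //; apply: sub Ox _; rewrite ns xr.
- move=> r [r0 [x Ox xr]]; have [y Oy xy] := up x Ox; rewrite xr in xy.
  by exists (enorm y) => //; split; [exact: sqrtr_ge0 | exists y].
- split=> //; exists 0; first exact: mem0.
  by rewrite -(scale0r (delta_mx ord0 k)) enorm_axis normr0.
Qed.

Lemma radii_near {R : realType} {I : set R} {r : R} :
  initial_interval I -> I r -> 0 < r -> \forall t \near r, 0 < t /\ I t.
Proof.
move=> hI Ir r0; have [s Is rs] := ii_open hI Ir.
near=> t; have t0 : 0 < t by near: t; exact: lt_nbhsr.
split=> //; apply: (ii_down hI Is (ltW t0)); apply: ltW.
by near: t; exact: lt_nbhsl.
Unshelve. all: by end_near. Qed.

Section radial.
Context {R : realType} {N : nat} {Omega : set 'rV[R]_N} {f : 'rV[R]_N -> R}.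
Context {F : R -> R} (k : 'I_N).
Hypothesis hO : ball_like Omega.
Hypothesis hf : C2_on Omega f.
Hypothesis hF : radial_profile Omega f F.

Let e : 'rV[R]_N := delta_mx ord0 k.
Let I := radii Omega.
Let hI : initial_interval I := radii_interval k hO.

Lemma axis_mem {r} : I r -> Omega (r *: e).
Proof.
move=> Ir; apply: (ball_like_mem hO); rewrite enorm_axis ger0_norm//.
exact: (ii_ge0 hI Ir).
Qed.

Lemma axis_deriv {r} : I r ->
  is_derive r 1 (fun t => f (t *: e)) (partial k f (r *: e)).
Proof.
move=> /axis_mem /(hf.1)[_ /(_ k)[df _]].
have := @line_deriv R N f 0 e r; rewrite add0r => /(_ df).
by rewrite (_ : (fun s => f (0 + s *: e)) = fun t => f (t *: e))//;
  apply: funext => t; rewrite add0r.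
Qed.

Lemma axis_deriv2 {r} : I r ->
  is_derive r 1 (fun t => partial k f (t *: e)) (partial k (partial k f) (r *: e)).
Proof.
move=> /axis_mem /(hf.2 k)[_ /(_ k)[df _]].
have := @line_deriv R N (partial k f) 0 e r; rewrite add0r => /(_ df).
by rewrite (_ : (fun s => partial k f (0 + s *: e)) = fun t => partial k f (t *: e))//;
  apply: funext => t; rewrite add0r.
Qed.

Lemma axis_profile {r} : I r -> F r = f (r *: e).
Proof.
move=> Ir; rewrite hF ?enorm_axis ?ger0_norm ?(ii_ge0 hI Ir)//.
exact: axis_mem.
Qed.

(** The profile is prescribed only on [I]; for [r > 0] a whole neighbourhood of [r] lies in [I], so
    [F] can be replaced by [f] on the axis. *)
Lemma profile_deriv1 {r} : I r -> 0 < r ->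
  (F^`())%classic r = partial k f (r *: e).
Proof.
move=> Ir r0; rewrite derive1E; have [_ <-] := axis_deriv Ir.
apply: near_eq_derive; near=> t.
have [_ It] : 0 < t /\ I t by near: t; exact: radii_near.
exact: axis_profile.
Unshelve. all: by end_near. Qed.

Lemma profile_deriv2 {r} : I r -> 0 < r ->
  (F^`(2))%classic r = partial k (partial k f) (r *: e).
Proof.
move=> Ir r0; rewrite derive1nS derive1n1 derive1E; have [_ <-] := axis_deriv2 Ir.
apply: near_eq_derive; near=> t.
have [t0 It] : 0 < t /\ I t by near: t; exact: radii_near.
exact: profile_deriv1.
Unshelve. all: by end_near. Qed.

Lemma axis_cont {r} : I r -> continuous_at r (fun t => f (t *: e)).
Proof. by move=> Ir; exact: (deriv_cont (axis_deriv Ir)). Qed.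

Lemma axis_cont_partial {r} : I r -> continuous_at r (fun t => partial k f (t *: e)).
Proof. by move=> Ir; exact: (deriv_cont (axis_deriv2 Ir)). Qed.

(* In a direction orthogonal to the axis, [f] is [F (sqrt (r ^ 2 + h ^ 2))]. *)
Lemma transverse_second_deriv {i : 'I_N} {r} : i != k -> I r -> 0 < r ->
  partial i (partial i f) (r *: e) = partial k f (r *: e) / r.
Proof.
move=> ik Ir r0.
pose d : 'rV[R]_N := delta_mx ord0 i.
pose s (h : R) : R := Num.sqrt (r ^+ 2 + h ^+ 2).
pose G t := partial k f (t *: e).
have q0 h : 0 < r ^+ 2 + h ^+ 2.
  by rewrite ltr_pwDl ?exprn_gt0 ?sqr_ge0.
have s0 h : 0 < s h by rewrite sqrtr_gt0.
have ds (h : R) : is_derive h 1 s (h / s h).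
  have dq : is_derive h 1 (fun h : R => r ^+ 2 + h ^+ 2) (2 * h).
    apply: deriv_eq; split.
      exact: (derivD (derivC (r ^+ 2) h) (derivX 1 h)).
    by rewrite add0r expr1.
  apply: deriv_eq; split; first exact: (@is_derive1_comp R Num.sqrt
    (fun h : R => r ^+ 2 + h ^+ 2) h _ _ (is_derive1_sqrt (q0 h)) dq).
  rewrite -/(s h); field; rewrite gt_eqF//.
have sr : s 0 = r by rewrite /s expr0n addr0 sqrtr_sqr gtr0_norm.
have near_I : \forall h \near (0 : R), I (s h).
  have := deriv_cont (ds 0); rewrite /continuous_at sr => cs.
  have := cs _ (radii_near hI Ir r0).
  by apply: filterS => h [].
have memO h : I (s h) -> Omega (r *: e + h *: d).
  by move=> Ih; apply: (ball_like_mem hO); rewrite enorm_line.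
have d1 h : I (s h) -> (\forall y \near h, I (s y)) ->
    partial i f (r *: e + h *: d) = h * (G (s h) / s h).
  move=> Ih nI; have [_ /(_ i)[df _]] := hf.1 _ (memO h Ih).
  rewrite [LHS]/partial; have [_ <-] := line_deriv df.
  have D := @is_derive1_comp R (fun t => f (t *: e)) s h _ _ (axis_deriv Ih) (ds h).
  rewrite mulrCA; have [_ <-] := D.
  apply: near_eq_derive; near=> y; rewrite /=.
  have Iy : I (s y) by near: y.
  rewrite hF; last exact: memO.
  by rewrite enorm_line// -/(s y) axis_profile.
have near_d1 : \forall h \near (0 : R),
    partial i f (r *: e + h *: d) = h * (G (s h) / s h).
  have := near_join near_I; apply: filterS => h hh.
  by apply: d1 => //; exact: nbhs_singleton hh.
have Is0 : I (s 0) by rewrite sr.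
have [_ /(_ i)[df _]] := hf.2 i _ (memO 0 Is0).
have [_ D2] := line_deriv df; rewrite scale0r addr0 in D2.
rewrite [LHS]/partial -D2.
rewrite (near_eq_derive _ near_d1).
have dG : is_derive (s 0) 1 G (partial k (partial k f) (s 0 *: e)).
  exact: axis_deriv2.
(* At [h = 0] the factor [h] kills the derivative of [G (s h) / s h], which leaves [G r / r]. *)
have [_ ->] := derivM (derivI 0) (derivM (@is_derive1_comp R G s 0 _ _ dG (ds 0))
  (derivV (f := s) (lt0r_neq0 (s0 0)) (ds 0))).
by rewrite mul0r addr0 mul1r /= sr.
Unshelve. all: by end_near. Qed.

Lemma radial_laplacian {r} : I r -> 0 < r ->
  laplacian f (r *: e) =
  partial k (partial k f) (r *: e) + N.-1%:R * partial k f (r *: e) / r.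
Proof.
move=> Ir r0; rewrite /laplacian (bigD1 k)//=; congr (_ + _).
rewrite (eq_bigr (fun=> partial k f (r *: e) / r)); last first.
  by move=> i ik; exact: transverse_second_deriv.
rewrite sumr_const (eq_card (_ : _ =i predC1 k)); last by move=> i; rewrite !inE.
by rewrite cardC1 card_ord -[LHS]mulr_natl mulrA.
Qed.

End radial.

(** * Small values of the sources, and the system satisfied by a solution *)

(** If [f >= c] everywhere, two integrations give [m >= b r] and [u <= u 0 - b r ^ 2 / 2], which is
    negative for large [r]. *)
Lemma global_source_vanishes {R : realType} {j : nat} {p : R} {I : set R}
    {u m f v n : R -> R} (hI : initial_interval I)
    (Hu : half_system j p I u m f v n) (global : forall r, 0 <= r -> I r) {c : R} :
  0 < c -> exists2 r, I r & f r < c.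
Proof.
move=> c0; apply: contrapT => hn.
have fc r : 0 <= r -> c <= f r.
  by move=> r0; rewrite leNgt; apply/negP => fr; apply: hn; exists r => //; exact: global.
(* With this value [r ^+ j.+1 * (b * r)] has derivative [c * r ^+ j.+1]. *)
pose b : R := c / j.+2%:R.
have b0 : 0 < b by rewrite divr_gt0.
have mb r : 0 < r -> b * r <= m r.
  move=> r0; have rj : 0 < r ^+ j.+1 by rewrite exprn_gt0.
  rewrite -subr_ge0 -(pmulr_rge0 _ rj).
  have := @segment_le R (fun y => y ^+ j.+1 * (m y - b * y))
    (fun y => y ^+ j.+1 * (f y - c)) 0 r (ltW r0).
  rewrite expr0n mul0r; apply => x.
  - move=> /andP[x0 _]; have ? := hs_m Hu (global x x0).
    by apply: contM; [exact: contX | apply: contB => //; apply: contM;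
      [exact: contC | exact: contI]].
  - move=> /andP[x0 _]; have dm := hs_dm Hu (global x (ltW x0)) x0.
    apply: deriv_eq; split.
      exact: (derivM (derivX j x) (derivB dm (derivM (derivC b x) (derivI x)))).
    rewrite /b exprS -[j.+2%:R]natr1 -!natr1; field.
    by rewrite !natr1 pnatr_eq0 /= gt_eqF.
  - move=> /andP[x0 _]; rewrite mulr_ge0 ?subr_ge0 ?fc ?exprn_ge0//; exact: ltW.
have ub r : 0 < r -> u r + b / 2 * r ^+ 2 <= u 0.
  move=> r0; have := @segment_ge R (fun y => u y + b / 2 * y ^+ 2)
    (fun y => - m y + b * y) 0 r (ltW r0).
  rewrite expr0n mulr0 addr0; apply => x.
  - move=> /andP[x0 _]; have ? := hs_u Hu (global x x0).
    by apply: contD => //; apply: contM; [exact: contC | exact: contX].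
  - move=> /andP[x0 _]; have du := hs_du Hu (global x (ltW x0)) x0.
    apply: deriv_eq; split.
      exact: (derivD du (derivM (derivC (b / 2) x) (derivX 1 x))).
    by rewrite expr1; field.
  - by move=> /andP[x0 _]; rewrite addrC subr_le0 mb.
have u0 := hs_u0 Hu (global 0 (lexx 0)).
(* As [r >= 1], [b / 2 * r ^+ 2] is at least [b / 2 * r = b / 2 + u 0], more than [u 0]. *)
pose r := 1 + 2 * u 0 / b.
have k0 : 0 < 2 * u 0 / b by rewrite divr_gt0 ?mulr_gt0.
have r0 : 0 < r by rewrite /r; lra.
have := ub r r0; have := hs_u0 Hu (global r (ltW r0)) => ur.
have : b / 2 * r <= b / 2 * r ^+ 2.
  by rewrite ler_pM2l ?divr_gt0// expr2 ler_peMl ?(ltW r0)// /r; lra.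
have -> : b / 2 * r = b / 2 + u 0 by rewrite /r; field; rewrite gt_eqF.
by lra.
Qed.

Lemma radial_equation {R : realType} {j : nat} {lambda p : R}
    {Omega : set 'rV[R]_j.+2} {u v : 'rV[R]_j.+2 -> R} {U : R -> R} (k : 'I_j.+2)
    (hO : ball_like Omega) (hu : C2_on Omega u) (l0 : 0 < lambda)
    (eq_u : forall x, Omega x -> lambda * laplacian u x + v x `^ p = 0)
    (hU : radial_profile Omega u U) {r : R} : radii Omega r -> 0 < r ->
  partial k (partial k u) (r *: delta_mx ord0 k) =
  j.+1%:R * - partial k u (r *: delta_mx ord0 k) / r
  - v (r *: delta_mx ord0 k) `^ p / lambda.
Proof.
move=> Ir r0; have := eq_u _ (axis_mem k hO Ir).
rewrite (radial_laplacian k hO hu hU Ir r0) /= => h.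
have -> : v (r *: delta_mx ord0 k) `^ p = - (lambda *
  (partial k (partial k u) (r *: delta_mx ord0 k) +
   j.+1%:R * partial k u (r *: delta_mx ord0 k) / r)) by lra.
by field; rewrite !gt_eqF.
Qed.

(** Positivity of [v] makes the source differentiable also when [p < 1], and lets its derivative be
    written with [v ^ p / v] for [v ^ (p - 1)]. *)
Lemma solution_half_system {R : realType} {j : nat} {lambda p : R}
    {Omega : set 'rV[R]_j.+2} {u v : 'rV[R]_j.+2 -> R} (k : 'I_j.+2)
    (hO : ball_like Omega) (hu : C2_on Omega u) (hv : C2_on Omega v)
    (l0 : 0 < lambda) (p0 : 0 < p)
    (eq_u : forall x, Omega x -> lambda * laplacian u x + v x `^ p = 0)
    (u0 : forall x, Omega x -> 0 < u x) (v0 : forall x, Omega x -> 0 < v x)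
    {U : R -> R} (hU : radial_profile Omega u U) :
  half_system j p (radii Omega)
    (fun r => u (r *: delta_mx ord0 k))
    (fun r => - partial k u (r *: delta_mx ord0 k))
    (fun r => v (r *: delta_mx ord0 k) `^ p / lambda)
    (fun r => v (r *: delta_mx ord0 k))
    (fun r => - partial k v (r *: delta_mx ord0 k)).
Proof.
have mem r : radii Omega r -> Omega (r *: delta_mx ord0 k) by exact: axis_mem.
have dsrc r : radii Omega r ->
    is_derive r 1 (fun r => v (r *: delta_mx ord0 k) `^ p / lambda)
    (- (p * (v (r *: delta_mx ord0 k) `^ p / lambda)
        * - partial k v (r *: delta_mx ord0 k) / v (r *: delta_mx ord0 k))).
  move=> Ir; have vr := v0 _ (mem r Ir).
  have D := @is_derive1_comp R (fun y => y `^ p) (fun t => v (t *: delta_mx ord0 k))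
    r _ _ (is_derive1_powR p vr) (axis_deriv k hO hv Ir).
  apply: deriv_eq; split; first exact: (derivM D (derivC (lambda^-1) r)).
  rewrite -(mulr_powRB1 (ltW vr) p0); field.
  by rewrite !gt_eqF.
split.
- by move=> r Ir; exact: (axis_cont k hO hu Ir).
- by move=> r Ir; apply: contN; exact: (axis_cont_partial k hO hu Ir).
- by move=> r Ir; exact: (deriv_cont (dsrc r Ir)).
- by move=> r /mem /u0.
- by move=> r /mem /v0 vr; rewrite divr_gt0 ?powR_gt0.
- by move=> r Ir r0; rewrite opprK; exact: (axis_deriv k hO hu Ir).
- move=> r Ir r0.
  have D := derivB (derivC 0 r) (axis_deriv2 k hO hu Ir).
  have E : (fun r : R => - partial k u (r *: delta_mx ord0 k))
      = (fun r : R => 0 - partial k u (r *: delta_mx ord0 k)).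
    by apply: funext => t; rewrite sub0r.
  rewrite E; apply: deriv_eq; split; first exact: D.
  by rewrite (radial_equation k hO hu l0 eq_u hU Ir r0); ring.
- by move=> r Ir r0; exact: dsrc.
Qed.

Lemma setT_ball_like {R : realType} {N : nat} (k : 'I_N) :
  ball_like ([set: 'rV[R]_N]).
Proof.
split=> // x _; exists ((enorm x + 1) *: delta_mx ord0 k) => //.
have n0 : 0 <= enorm x by exact: sqrtr_ge0.
by rewrite enorm_axis ger0_norm; lra.
Qed.

Lemma eball_ball_like {R : realType} {N : nat} (k : 'I_N) {rho : R} : 0 < rho ->
  ball_like (eball (N := N) rho).
Proof.
move=> rho0; split.
- by rewrite /eball /= -(scale0r (delta_mx ord0 k)) enorm_axis normr0.
- by move=> x y; rewrite /eball /= => xr yx; exact: le_lt_trans yx xr.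
- rewrite /eball /= => x xr; have n0 : 0 <= enorm x by exact: sqrtr_ge0.
  exists (((enorm x + rho) / 2) *: delta_mx ord0 k); rewrite /= enorm_axis ger0_norm; lra.
Qed.

Lemma dirichlet_source_vanishes {R : realType} {N : nat} (k : 'I_N)
    {rho lambda p c : R} {v : 'rV[R]_N -> R} :
  0 < rho -> 0 < lambda -> 0 < p -> 0 < c ->
  (forall x, eball rho x -> 0 < v x) -> dirichlet_on_ball rho v ->
  exists2 r, radii (eball (N := N) rho) r
    & v (r *: delta_mx ord0 k) `^ p / lambda < c.
Proof.
move=> rho0 l0 p0 c0 vpos [cv v0].
pose e : 'rV[R]_N := delta_mx ord0 k.
have ne r : 0 <= r -> enorm (r *: e) = r by move=> r0; rewrite enorm_axis ger0_norm.
have clr : cleball rho (rho *: e) by rewrite /cleball /= ne// ltW.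
have cr := (@subspace_continuousP _ _ _ v).1 cv _ clr.
rewrite v0 ?ne ?ltW// in cr.
(* The value of [v] at which the source equals [c]. *)
pose b := (c * lambda) `^ p^-1.
have b0 : 0 < b by rewrite powR_gt0 ?mulr_gt0.
have near_b : within (cleball rho) (nbhs (rho *: e)) (fun x => v x < b).
  exact: (@cvgr_lt R _ (within (cleball rho) (nbhs (rho *: e))) _ v 0 cr b b0).
have ce : {for rho, continuous (fun t : R => t *: e)} by exact: scalel_continuous.
have : nbhs rho (fun t : R => cleball rho (t *: e) -> v (t *: e) < b) := ce _ near_b.
move=> /nbhs_ballP[d /= d0 hd].
(* A positive radius strictly inside the ball and within [d] of its boundary. *)
pose t := Num.max (rho / 2) (rho - d / 2).
have t0 : 0 < t by rewrite lt_max divr_gt0.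
have trho : t < rho by rewrite gt_max; apply/andP; split; lra.
have td : rho - d / 2 <= t by rewrite le_max lexx orbT.
have tb : eball rho (t *: e) by rewrite /eball /= ne ?ltW.
have vt : v (t *: e) < b.
  apply: hd; last by rewrite /cleball /= ne ltW.
  by rewrite /ball /= gtr0_norm ?subr_gt0//; lra.
exists t; first by split; [exact: ltW | exists (t *: e); rewrite ?ne ?ltW].
rewrite ltr_pdivrMr//.
have -> : c * lambda = b `^ p.
  by rewrite -powRrM mulVf ?gt_eqF// powRr1// ltW// mulr_gt0.
by apply: gt0_ltr_powR => //; rewrite nnegrE ltW//; exact: vpos.
Qed.

(** * The hyperbola and the conclusion *)

(** This is [1 / (p + 1) + 1 / (q + 1) >= (N - 2) / N] with [N = j + 2], arranged as the bound on
    [a] in the energy. *)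
Lemma below_hyperbola {R : realType} {j : nat} {p q : R} :
  0 < p -> 0 < q -> 1 < p * q ->
  j.+2%:R - 2 <= alpha_exp p q + beta_exp p q ->
  j%:R - (j%:R + 2) / (q + 1) <= (j%:R + 2) / (p + 1).
Proof.
move=> p0 q0 pq; rewrite /alpha_exp /beta_exp -mulrDl ler_pdivlMr ?subr_gt0//.
have -> : j.+2%:R - 2 = j%:R :> R by rewrite -addn2 natrD addrK.
have p1 : 0 < p + 1 by lra.
have q1 : 0 < q + 1 by lra.
move: (j%:R) => k h.
rewrite -subr_ge0.
have -> : (k + 2) / (p + 1) - (k - (k + 2) / (q + 1)) =
    (2 * (p + 1) + 2 * (q + 1) - k * (p * q - 1)) / ((p + 1) * (q + 1)).
  by field; rewrite !gt_eqF.
by rewrite divr_ge0 ?subr_ge0//; apply: mulr_ge0; exact: ltW.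
Qed.

Lemma profile_concavity {R : realType} {j : nat} {lambda p q : R}
    {Omega : set 'rV[R]_j.+2} {u v : 'rV[R]_j.+2 -> R} {U V : R -> R}
    (l0 : 0 < lambda) (p0 : 0 < p) (q0 : 0 < q) (pq : 1 < p * q)
    (hyp : j%:R - (j%:R + 2) / (q + 1) <= (j%:R + 2) / (p + 1))
    (hOmega : Omega = setT \/
       exists rho : R, [/\ 0 < rho, Omega = eball rho,
         dirichlet_on_ball rho u & dirichlet_on_ball rho v])
    (huv : classical_solution lambda p q Omega u v)
    (hU : radial_profile Omega u U) (hV : radial_profile Omega v V) :
  changes_concavity_exactly_once (positive_radii Omega) U.
Proof.
have [hu hv sol] := huv.
pose k : 'I_j.+2 := ord0.
have hO : ball_like Omega.
  case: hOmega => [->|[rho [rho0 -> _ _]]]; first exact: setT_ball_like k.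
  exact: eball_ball_like k _ rho0.
have hI := radii_interval k hO.
have u0 x : Omega x -> 0 < u x by move=> /sol[].
have v0 x : Omega x -> 0 < v x by move=> /sol[].
have eq_u x : Omega x -> lambda * laplacian u x + v x `^ p = 0 by move=> /sol[].
have eq_v x : Omega x -> lambda * laplacian v x + u x `^ q = 0 by move=> /sol[].
have Hu := solution_half_system k hO hu hv l0 p0 eq_u u0 v0 hU.
have Hv := solution_half_system k hO hv hu l0 q0 eq_v v0 u0 hV.
have global : Omega = setT -> forall r, 0 <= r -> radii Omega r.
  move=> OT r r0; split=> //; exists (r *: delta_mx ord0 k); first by rewrite OT.
  by rewrite enorm_axis ger0_norm.
have hf b : 0 < b -> exists2 r, radii Omega r &
    v (r *: delta_mx ord0 k) `^ p / lambda < b.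
  move=> b0; case: hOmega => [OT|[rho [rho0 Or _ dv]]].
    exact: (global_source_vanishes hI Hu (global OT) b0).
  by rewrite Or in v0 *; exact: dirichlet_source_vanishes.
have hg b : 0 < b -> exists2 r, radii Omega r &
    u (r *: delta_mx ord0 k) `^ q / lambda < b.
  move=> b0; case: hOmega => [OT|[rho [rho0 Or du _]]].
    exact: (global_source_vanishes hI Hv (global OT) b0).
  by rewrite Or in u0 *; exact: dirichlet_source_vanishes.
have [c [Ic c0] hc] := curvature_sign_change hI Hu Hv p0 q0 pq hyp hf hg.
have posE r : positive_radii Omega r -> 0 < r /\ radii Omega r.
  by move=> [r0 hr]; split => //; split => //; exact: ltW.
exists c; first by case: Ic.
move=> r s /posE[r0 Ir] /posE[s0 Is] rc cs.
rewrite (profile_deriv2 k hO hu hU Ir r0) (profile_deriv2 k hO hu hU Is s0).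
by rewrite !(radial_equation k hO hu l0 eq_u hU)//; exact: hc.
Qed.

Theorem theorem1p4 (R : realType) (N : nat) (lambda p q : R)
    (Omega : set 'rV[R]_N) (u v : 'rV[R]_N -> R) (U V : R -> R)
    (hN : (3 <= N)%N) (hlambda : 0 < lambda)
    (hp : 0 < p) (hq : 0 < q) (hpq : 1 < p * q)
    (hbelow : N%:R - 2 <= alpha_exp p q + beta_exp p q)
    (hOmega : Omega = setT \/
       exists rho : R, [/\ 0 < rho, Omega = eball (N := N) rho,
         dirichlet_on_ball rho u & dirichlet_on_ball rho v])
    (huv : classical_solution lambda p q Omega u v)
    (hU : radial_profile Omega u U) (hV : radial_profile Omega v V) :
  changes_concavity_exactly_once (positive_radii Omega) U /\
  changes_concavity_exactly_once (positive_radii Omega) V.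
Proof.
case: N => [|[|j]] // in Omega u v hN hbelow hOmega huv hU hV *.
have hyp := below_hyperbola hp hq hpq hbelow.
split; first exact: profile_concavity hyp hOmega huv hU hV.
(* The problem is invariant under exchanging [u], [p] with [v], [q]. *)
apply: (profile_concavity hlambda hq hp _ _ _ _ hV hU).
- by rewrite mulrC.
- by move: hyp; rewrite !lerBlDr addrC.
- case: hOmega => [|[rho [rho0 Or du dv]]]; [by left | by right; exists rho].
- by case: huv => hu hv sol; split => // x /sol[].
Qed.
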